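(* Let $n\ge 1$, let $P=\{p_1,\dots,p_n\}$ be worker performance rates with $0<p_j\le 1$, let $\alpha\in\mathbb{R}$ be a threshold, let $X=\{x_1,\dots,x_n\}$ be job values (positive reals) arriving sequentially in the order $x_1,x_2,\dots,x_n$ (each $x_i$ being a realization of a random variable with distribution $G_{X_i}$), and let $f:X\times P\to\mathbb{R}$ be order-preserving in the argument of $P$. Consider the following assignment policy $\pi^*$: when $x_i$ arrives, assign it to a worker $j$, among the workers not already assigned, whose performance rate $p_j$ minimizes $f(x_i,p)$ subject to $f(x_i,p)\ge\alpha$, where $p$ ranges over the performance rates of the not-yet-assigned workers; if no not-yet-assigned worker satisfies $f(x_i,p)\ge\alpha$, reject $x_i$. Then, for every realization $x_1,\dots,x_n$ of the job values, the assignment produced by $\pi^*$ attains the maximum $$r(X)=\max_{\pi}\ \sum_{i=1}^{n}\mathbf{1}_{\left\{\sum_{j=1}^{n}A_{ij}f(x_i,p_j)\ge\alpha\right\}},$$ where the maximum is over all assignments $\pi=(A_{ij})$ with $A_{ij}\in\{0,1\}$, $\sum_{j=1}^n A_{ij}\le 1$ for all $i$, and $\sum_{i=1}^n A_{ij}\le 1$ for all $j$.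
   Context: Order-preserving: a function $f:X\times P\to\mathbb{R}$, with $X=\{x_1,\dots,x_n\}$ and $P=\{p_1,\dots,p_n\}$ sets of positive reals, is order-preserving in the argument of $P$ if the order of the values $f(x,p_1),\dots,f(x,p_n)$ does not depend on $x\in X$; that is, for all $x,x'\in X$ and $p,q\in P$, $f(x,p)\le f(x,q)$ if and only if $f(x',p)\le f(x',q)$. $A_{ij}=1$ means that job $i$ is assigned to worker $j$; each job goes to at most one worker and each worker serves at most one job (workers are not reassigned). A job assigned to no worker is rejected and contributes $0$ to the reward, so the reward counts the jobs $i$ assigned to some worker $j$ with $f(x_i,p_j)\ge\alpha$. Ties in the minimization defining $\pi^*$ are broken arbitrarily. *)

(* Defs.v *)
From mathcomp Require Import all_boot all_order all_algebra reals.

Set Implicit Arguments.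
Unset Strict Implicit.
Unset Printing Implicit Defensive.

Import Order.TTheory GRing.Theory Num.Theory.
Local Open Scope ring_scope.

(* A function f : X * P -> R is represented by a total f : R -> R -> R; only
   its values on X * P are ever used. *)
Definition order_preserving (R : realType) (X P : seq R) (f : R -> R -> R) :
    Prop :=
  forall x x' p q, x \in X -> x' \in X -> p \in P -> q \in P ->
    (f x p <= f x q) <-> (f x' p <= f x' q).

(* Row i is a job, column j a worker; the entries true and false stand for
   A_ij = 1 and A_ij = 0. *)
Definition feasible (n : nat) (A : 'M[bool]_n) : bool :=
  [forall i, (\sum_(j < n) A i j <= 1)%N] &&
  [forall j, (\sum_(i < n) A i j <= 1)%N].

(* The first conjunct matters only when alpha <= 0: a rejected job, whose inner
   sum is 0, must not be counted. *)
Definition reward (R : realType) (n : nat) (x p : 'I_n -> R) (f : R -> R -> R)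
    (alpha : R) (A : 'M[bool]_n) : nat :=
  (\sum_(i < n) ([exists j, A i j] &&
     (alpha <= \sum_(j < n) (A i j)%:R * f (x i) (p j))%R))%N.

(* The zero assignment is feasible, so this is a maximum over a nonempty set. *)
Definition max_reward (R : realType) (n : nat) (x p : 'I_n -> R)
    (f : R -> R -> R) (alpha : R) : nat :=
  (\max_(A : 'M[bool]_n | feasible A) reward x p f alpha A)%N.

Definition free_workers (n : nat) (A : 'M[bool]_n) (i : 'I_n) : {set 'I_n} :=
  [set j | [forall k : 'I_n, (k < i)%N ==> ~~ A k j]].

Definition eligible (R : realType) (n : nat) (p : 'I_n -> R) (f : R -> R -> R)
    (alpha : R) (U : {set 'I_n}) (y : R) : {set 'I_n} :=
  [set j in U | alpha <= f y (p j)].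

(* The decisions pi* may take on a job of value y when U is the set of
   unassigned workers: Some j assigns it to j, None rejects it. Several j are
   allowed in case of ties. *)
Definition pi_star_decision (R : realType) (n : nat) (p : 'I_n -> R)
    (f : R -> R -> R) (alpha : R) (U : {set 'I_n}) (y : R)
    (o : option 'I_n) : Prop :=
  match o with
  | Some j => j \in eligible p f alpha U y /\
      forall k, k \in eligible p f alpha U y -> f y (p j) <= f y (p k)
  | None => eligible p f alpha U y = set0
  end.

(* A results from running pi* on x_0, x_1, ... with some way of breaking ties.
   free_workers A i only looks at the rows of A before i, so this describes a
   sequential process. *)
Definition pi_star_assignment (R : realType) (n : nat) (x p : 'I_n -> R)
    (f : R -> R -> R) (alpha : R) (A : 'M[bool]_n) : Prop :=
  forall i, exists o : option 'I_n,
    pi_star_decision p f alpha (free_workers A i) (x i) o /\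
    forall j, A i j = (o == Some j).

(* Main.v *)
Require Import Defs.
From mathcomp Require Import all_boot all_order all_algebra reals.

Set Implicit Arguments.
Unset Strict Implicit.
Unset Printing Implicit Defensive.

Import Order.TTheory GRing.Theory Num.Theory.
Local Open Scope ring_scope.

(** Optimality is witnessed by a vertex cover, as in Koenig's theorem.  Let
    [N i] be the set of all workers able to do job [i], and let [U] be the
    union of those [N i] all of whose workers are employed by pi*.  Any
    assignment earns at most #|U| from the jobs with [N i] inside [U], plus the
    number of the other jobs.  Under pi* every other job is accepted, and every
    worker of [U] serves a job with [N i] inside [U]: order preservation makes
    [U] upward closed for the common order of the workers, so if pi* sends [i]
    to a worker of [U], the workers of [N i] that were free at that time lie in
    [U] by minimality, and hence all of [N i] is employed.  So pi* meets the
    bound. *)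

(** Each [j] has at most one [r]-preimage, so sending [j] to it is a partial map whose image of [B]
    covers [D]. No injection from [D] to [B] has to be chosen. *)
Lemma leq_card_rel (T1 T2 : finType) (r : T1 -> T2 -> bool)
    (D : {set T1}) (B : {set T2}) :
  (forall i i' j, r i j -> r i' j -> i = i') ->
  (forall i, i \in D -> exists2 j, j \in B & r i j) ->
  (#|D| <= #|B|)%N.
Proof.
have Some_inj : injective (@Some T1) by move=> ? ? [].
move=> r_inj rD; rewrite -(card_imset (mem D) Some_inj).
apply: leq_trans (leq_imset_card (fun j => [pick i | r i j]) (mem B)).
apply/subset_leq_card/subsetP => _ /imsetP[i /rD[j jB rij] ->].
apply/imsetP; exists j => //; case: pickP => [i' ri'j | /(_ i)].
  by rewrite (r_inj _ _ _ rij ri'j).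
by rewrite rij.
Qed.

Lemma sum_bool_card (T : finType) (b : pred T) : (\sum_i b i)%N = #|[set i | b i]|.
Proof. by rewrite -sum1dep_card [RHS]big_mkcond; apply: eq_bigr => i _; case: (b i). Qed.

Lemma sum_bool_le1P (T : finType) (b : pred T) :
  reflect (forall i i', b i -> b i' -> i = i') (\sum_i b i <= 1)%N.
Proof.
rewrite sum_bool_card; apply: (iffP (card_le1_eqP (A := mem [set i | b i]))).
  by move=> h i i' bi bi'; apply: h; rewrite inE.
by move=> h i i'; rewrite !inE => bi bi'; exact: h.
Qed.

Lemma feasibleP (n : nat) (A : 'M[bool]_n) :
  reflect ((forall i j j', A i j -> A i j' -> j = j') /\
           (forall i i' j, A i j -> A i' j -> i = i')) (feasible A).
Proof.
apply: (iffP andP) => -[rows cols]; split.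
- by move=> i; apply/sum_bool_le1P/(forallP rows).
- by move=> i i' j; move: i i'; apply/sum_bool_le1P/(forallP cols).
- by apply/forallP => i; apply/sum_bool_le1P/rows.
- by apply/forallP => j; apply/sum_bool_le1P => i i'; apply: cols.
Qed.

(** A row of a feasible matrix has at most one true entry, so the inner sum collapses to a single
    value of [f]. *)
Lemma reward_card (R : realType) (n : nat) (x p : 'I_n -> R) (f : R -> R -> R)
    (alpha : R) (A : 'M[bool]_n) :
  feasible A ->
  reward x p f alpha A =
  #|[set i | [exists j, A i j && (alpha <= f (x i) (p j))]]|.
Proof.
move=> /feasibleP[rowA _]; rewrite /reward sum_bool_card; apply: eq_card => i.
have sumA j : A i j -> \sum_k (A i k)%:R * f (x i) (p k) = f (x i) (p j).
  move=> Aij; rewrite (bigD1 j) //= Aij mul1r big1 ?addr0 // => k kj.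
  case Aik: (A i k); last by rewrite mul0r.
  by rewrite (rowA _ _ _ Aik Aij) eqxx in kj.
rewrite !inE; apply/andP/existsP => [[/existsP[j Aij]]|[j /andP[Aij ej]]].
  by rewrite (sumA _ Aij) => ej; exists j; rewrite Aij.
by split; [apply/existsP; exists j | rewrite (sumA _ Aij)].
Qed.

Lemma pi_star_decision_ex (R : realType) (n : nat) (p : 'I_n -> R)
    (f : R -> R -> R) (alpha : R) (U : {set 'I_n}) (y : R) :
  exists o, pi_star_decision p f alpha U y o.
Proof.
have [E0|[j0 Ej0]] := set_0Vmem (eligible p f alpha U y); first by exists None.
by case: (arg_minP (fun j => f y (p j)) Ej0) => j Ej jmin; exists (Some j).
Qed.

Lemma eq_free_workers (n : nat) (A B : 'M[bool]_n) (i : 'I_n) :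
  (forall k : 'I_n, (k < i)%N -> A k =1 B k) ->
  free_workers A i = free_workers B i.
Proof.
move=> eqAB; apply/setP => j; rewrite !inE; apply: eq_forallb => k.
by case: ltnP => // /eqAB ->.
Qed.

(** Shows that the optimality claim is not vacuous. *)
Lemma pi_star_assignment_ex (R : realType) (n : nat) (x p : 'I_n -> R)
    (f : R -> R -> R) (alpha : R) :
  exists A, pi_star_assignment x p f alpha A.
Proof.
(* Rows are filled in order of arrival. Those from [m] on stay arbitrary, since a decision depends
   only on earlier rows. *)
suff rowsP m : (m <= n)%N -> exists A : 'M[bool]_n, forall i : 'I_n, (i < m)%N ->
    exists o, pi_star_decision p f alpha (free_workers A i) (x i) o /\
      forall j, A i j = (o == Some j).
  by have [A hA] := rowsP n (leqnn n); exists A => i; apply: hA.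
elim: m => [|m IHm] lemn; first by exists (const_mx false).
have [A hA] := IHm (ltnW lemn).
pose m' := Ordinal lemn.
have [o ho] := pi_star_decision_ex p f alpha (free_workers A m') (x m').
pose B : 'M[bool]_n := \matrix_(i, j) if i == m' then o == Some j else A i j.
have freeB (i : 'I_n) : (i <= m)%N -> free_workers B i = free_workers A i.
  move=> im; apply: eq_free_workers => k ki j; rewrite mxE.
  by rewrite -val_eqE /= (ltn_eqF (leq_trans ki im)).
exists B => i; rewrite ltnS => im; rewrite freeB //.
have [->|im'] := eqVneq i m'.
  by exists o; split=> // j; rewrite mxE eqxx.
have [|o' [ho' Ao']] := hA i; first by rewrite ltn_neqAle im andbT.
by exists o'; split=> // j; rewrite mxE (negPf im').
Qed.

Section PiStar.
Variables (R : realType) (n : nat) (x p : 'I_n -> R) (f : R -> R -> R).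
Variables (alpha : R) (A : 'M[bool]_n).
Hypothesis piA : pi_star_assignment x p f alpha A.

Lemma pi_star_assigned i j : A i j ->
  [/\ j \in free_workers A i, alpha <= f (x i) (p j) &
      forall k, k \in free_workers A i -> alpha <= f (x i) (p k) ->
        f (x i) (p j) <= f (x i) (p k)].
Proof.
have [o [ho Ao]] := piA i; rewrite Ao => /eqP oj; move: ho; rewrite oj /=.
rewrite inE => -[/andP[free_j ej] jmin]; split=> // k free_k ek.
by apply: jmin; rewrite inE free_k.
Qed.

Lemma pi_star_rejected i j : (forall k, ~~ A i k) -> alpha <= f (x i) (p j) ->
  j \notin free_workers A i.
Proof.
have [[k|] [ho Ao]] := piA i => rej ej; first by have:= rej k; rewrite Ao eqxx.
by apply/negP => free_j; move/setP/(_ j): ho; rewrite in_set free_j ej in_set0.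
Qed.

Lemma pi_star_feasible : feasible A.
Proof.
apply/feasibleP; split=> [i j j' | i i' j Aij Ai'j].
  by have [o [_ Ao]] := piA i; rewrite !Ao => /eqP-> /eqP[].
(* A worker taken by job [k] is no longer free for a later job [l], so neither of two jobs sharing a
   worker can precede the other. *)
have free_at k l : A k j -> A l j -> ~~ (k < l)%N.
  move=> Akj /pi_star_assigned[]; rewrite inE => /forallP/(_ k)/implyP free_j _ _.
  by apply/negP => /free_j; rewrite Akj.
case: (ltngtP i i') => [lt_ii'|lt_ii'|/val_inj //].
  by have:= free_at _ _ Aij Ai'j; rewrite lt_ii'.
by have:= free_at _ _ Ai'j Aij; rewrite lt_ii'.
Qed.

Let N i := [set j | alpha <= f (x i) (p j)].
Let used := [set j | [exists i, A i j]].
Let U := \bigcup_(i | N i \subset used) N i.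
(** Since [U] lies in [used], these are exactly the jobs with [N i \subset used]. *)
Let inU := [set i | N i \subset U].

Lemma not_free_used i j : j \notin free_workers A i -> j \in used.
Proof.
rewrite !inE negb_forall => /existsP[k]; rewrite negb_imply negbK => /andP[_ Akj].
by apply/existsP; exists k.
Qed.

Lemma saturated_sub i : N i \subset used -> i \in inU.
Proof. by move=> sN; rewrite inE (bigcup_sup i). Qed.

Lemma reward_le_cover (M : 'M[bool]_n) :
  feasible M -> (reward x p f alpha M <= #|U| + #|~: inU|)%N.
Proof.
move=> feasM; have /feasibleP[_ colM] := feasM.
rewrite reward_card // -(cardsID inU) leq_add //; last first.
  by rewrite subset_leq_card // setDE subsetIr.
(* Jobs of [inU] that earn a reward under [M] have distinct workers, all in [U]. *)
apply: (leq_card_rel (r := fun i j => M i j)) => // i.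
rewrite !inE => /andP[/existsP[j /andP[Mij ej]] /subsetP NU].
by exists j => //; apply: NU; rewrite inE.
Qed.

Hypothesis hf : order_preserving (codom x) (codom p) f.

Lemma assigned_to_cover i j : A i j -> j \in U -> i \in inU.
Proof.
move=> Aij /bigcupP[k sNk]; rewrite inE => ekj; apply: saturated_sub.
apply/subsetP => l; rewrite inE => eil.
have [free_l|] := boolP (l \in free_workers A i); last exact: not_free_used.
(* Minimality puts [j] below [l] for job [i]. Order preservation carries this over to job [k], which
   accepts [j] and hence [l]. *)
apply: (subsetP sNk); rewrite inE; apply: le_trans ekj _.
apply/(hf (codom_f x i) (codom_f x k) (codom_f p j) (codom_f p l)).
by have [_ _] := pi_star_assigned Aij; apply.
Qed.

Lemma cover_le_reward : (#|U| + #|~: inU| <= reward x p f alpha A)%N.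
Proof.
have /feasibleP[rowA _] := pi_star_feasible.
rewrite (reward_card _ _ _ _ pi_star_feasible) -[leqRHS](cardsID inU).
apply: leq_add.
  (* The roles are now reversed: each worker of [U] is matched to the job it serves, and a job has
     only one worker. *)
  apply: (leq_card_rel (r := fun j i => A i j)) => [j j' i|j jU]; first exact: rowA.
  have : j \in used by case/bigcupP: (jU) => k /subsetP; apply.
  rewrite inE => /existsP[i Aij]; exists i => //.
  rewrite in_setI (assigned_to_cover Aij jU) andbT inE; apply/existsP; exists j.
  by rewrite Aij; have [] := pi_star_assigned Aij.
apply/subset_leq_card/subsetP => i; rewrite in_setC in_setD => iU; rewrite iU inE.
have [/existsP[j Aij]|/existsPn rej] := boolP [exists j, A i j].
  by apply/existsP; exists j; rewrite Aij; have [] := pi_star_assigned Aij.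
(* A rejected job found none of its workers free, so all of [N i] is employed and [i] would belong
   to [inU]. *)
case/negP: iU; apply: saturated_sub; apply/subsetP => j; rewrite inE => ej.
exact: not_free_used (pi_star_rejected rej ej).
Qed.

Lemma pi_star_optimal : reward x p f alpha A = max_reward x p f alpha.
Proof.
apply/eqP; rewrite eqn_leq; apply/andP; split.
  exact: (leq_bigmax_cond _ pi_star_feasible).
apply/bigmax_leqP => M feasM.
exact: leq_trans (reward_le_cover feasM) cover_le_reward.
Qed.

End PiStar.

Theorem mainTheorem1 (R : realType) (n : nat) (hn : (1 <= n)%N)
    (p : 'I_n -> R) (hp : forall j, 0 < p j <= 1)
    (alpha : R)
    (x : 'I_n -> R) (hx : forall i, 0 < x i)
    (f : R -> R -> R) (hf : order_preserving (codom x) (codom p) f) :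
  (exists A : 'M[bool]_n, pi_star_assignment x p f alpha A) /\
  (forall A : 'M[bool]_n, pi_star_assignment x p f alpha A ->
     feasible A /\ reward x p f alpha A = max_reward x p f alpha).
Proof.
split; first exact: pi_star_assignment_ex.
by move=> A piA; split; [exact: pi_star_feasible piA | exact: pi_star_optimal].
Qed.
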